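(* Let $A$ be a finite set of cardinality $|A|>2$, and let $\mathcal{D}$ be the clone on $A$ generated by the discriminator function on $A$. If $\mathcal{H}$ is a proper subclone of $\mathcal{D}$ (i.e. a clone on $A$ with $\mathcal{H}\subsetneq\mathcal{D}$), then $\equiv_{\mathcal{H}}$ has infinite index in $\mathcal{O}_A$ (that is, there are infinitely many $\mathcal{H}$-equivalence classes of operations on $A$).
   Context: For a nonempty set $A$ and an integer $n\ge1$, an $n$-ary operation on $A$ is a function $A^n\to A$; $\mathcal{O}_A^{(n)}$ is the set of all $n$-ary operations and $\mathcal{O}_A=\bigcup_{n\ge1}\mathcal{O}_A^{(n)}$. The projections are $p_i^{(n)}(a_1,\dots,a_n)=a_i$ ($1\le i\le n$). An $m$-tuple $\mathbf{h}=(h_1,\dots,h_m)$ of $n$-ary operations is identified with the function $\mathbf{h}\colon A^n\to A^m$, and for $g\in\mathcal{O}_A^{(m)}$, $g\circ\mathbf{h}=g(h_1,\dots,h_m)\in\mathcal{O}_A^{(n)}$. A clone on $A$ is a set $\mathcal{C}\subseteq\mathcal{O}_A$ containing all projections and closed under composition: $g\circ\mathbf{h}\in\mathcal{C}$ whenever $g\in\mathcal{C}$ is $m$-ary and $\mathbf{h}$ is an $m$-tuple of $n$-ary members of $\mathcal{C}$. The clone generated by a set of operations is the smallest clone containing it. $\mathcal{C}^{(n)}$ is the set of $n$-ary members of $\mathcal{C}$. For a clone $\mathcal{C}$ on $A$, $f\in\mathcal{O}_A^{(n)}$ and $g\in\mathcal{O}_A^{(m)}$: $f\leq_{\mathcal{C}}g$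 if $f=g\circ\mathbf{h}$ for some $\mathbf{h}\in(\mathcal{C}^{(n)})^m$; $f$ and $g$ are $\mathcal{C}$-equivalent, written $f\equiv_{\mathcal{C}}g$, if $f\leq_{\mathcal{C}}g$ and $g\leq_{\mathcal{C}}f$. The discriminator function on $A$ is the ternary operation $t$ with $t(x,y,z)=z$ if $x=y$ and $t(x,y,z)=x$ otherwise. *)

(* Defs.v *)
From mathcomp Require Import all_boot.
From mathcomp Require Import boolp classical_sets cardinality.

Set Implicit Arguments.
Unset Strict Implicit.
Unset Printing Implicit Defensive.

Local Open Scope classical_set_scope.

Definition op (A : finType) (n : nat) := {ffun n.-tuple A -> A}.

(* All arities are at least 1: an element is a pair (n, f) with f of arity
   n.+1. *)
Definition operation (A : finType) := {n : nat & op A n.+1}.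

Definition Op (A : finType) (n : nat) (f : op A n.+1) : operation A :=
  existT (fun k => op A k.+1) n f.

Definition arity (A : finType) (f : operation A) : nat := (projT1 f).+1.

Definition fun_of (A : finType) (f : operation A) : op A (arity f) := projT2 f.

Definition proj (A : finType) (n : nat) (i : 'I_n) : op A n :=
  [ffun a : n.-tuple A => tnth a i].

Definition comp (A : finType) (m n : nat) (g : op A m) (h : 'I_m -> op A n) :
  op A n := [ffun a : n.-tuple A => g [tuple h i a | i < m]].

Definition is_clone (A : finType) (C : set (operation A)) : Prop :=
  (forall (n : nat) (i : 'I_n.+1), C (Op (proj A i))) /\
  (forall (m n : nat) (g : op A m.+1) (h : 'I_m.+1 -> op A n.+1),
     C (Op g) -> (forall i, C (Op (h i))) -> C (Op (comp g h))).

Definition clone_generated (A : finType) (S : set (operation A)) :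
  set (operation A) := smallest (@is_clone A) S.

Definition discriminator (A : finType) : op A 3 :=
  [ffun a : 3.-tuple A =>
     let x := tnth a (inord 0) in
     let y := tnth a (inord 1) in
     let z := tnth a (inord 2) in
     if x == y then z else x].

Definition discriminator_clone (A : finType) : set (operation A) :=
  clone_generated [set Op (discriminator A)].
Arguments discriminator_clone A : clear implicits.

Definition clone_le (A : finType) (C : set (operation A)) (f g : operation A) :
  Prop :=
  exists h : 'I_(arity g) -> op A (arity f),
    (forall i, C (Op (h i))) /\ fun_of f = comp (fun_of g) h.

Definition clone_equiv (A : finType) (C : set (operation A))
  (f g : operation A) : Prop := clone_le C f g /\ clone_le C g f.

Definition equiv_classes (A : finType) (C : set (operation A)) :
  set (set (operation A)) :=
  [set E | exists f : operation A, E = [set g | clone_equiv C f g]].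

(* Main.v *)
Require Import Defs.
From mathcomp Require Import all_boot.
From mathcomp Require Import boolp classical_sets cardinality.

(** Every operation of the discriminator clone is a pattern operation: its
    value is one of its arguments, at a position that depends only on which
    arguments coincide.  Fix two distinct elements [u] and [v].  On [{u, v}] a
    ternary pattern operation [g] is described by the triple of its values at
    [(u,u,v)], [(u,v,u)], [(v,u,u)]; the discriminator has triple [(v,u,v)],
    the majority operation [(u,u,u)] and the minority operation [(v,v,v)].

    A clone [H] of pattern operations containing some [q] with triple
    [(v,u,v)] contains the discriminator [t]: if [q] selects its first or its
    third argument on triples of distinct elements, then [t] is [q], or [q]
    with the outer variables exchanged, and otherwise
    [t(x,y,z) = q(Q, q(Q,x,z), z)] with [Q = q(x,y,z)]
    ([discriminator_of_binary_discriminator]).  A proper subclone [H] of the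
    discriminator clone has therefore no such [q], nor any obtained from it by
    permuting variables.  Two cases remain.

    If [H] has no operation that is a minority on [{u, v}], then all its
    operations are monotone on [{u, v}] for [u < v] ([monotone_of_no_minority]).
    The operations [parity_op n] colour the maximal chains of [{u, v}^(n+1)]
    alternately, and a monotone colour-preserving map cannot shorten such a
    chain, so these operations are pairwise inequivalent.

    If [H] has an operation that is a minority on [{u, v}], it has none that
    is a majority there, since [maj(x, z, min(x,y,z))] would have triple
    [(v,u,v)].  With [{u, v}] read as the two-element field, [u] being 0 and [v]
    being 1, the members of [H] then preserve the relation [x + y + z = 1]
    ([affine_of_minority]).  For the conjunctions [conj_op n], a reduction of
    [conj_op n] to [conj_op m] is thus an injective map from [{u, v}^(n+1)] to
    [{u, v}^(m+1)], because [h x = h y] makes [h (x + y + 1)] the all-[v]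
    tuple, whence [x + y + 1] is the all-[v] tuple and [x = y].  So these
    operations are pairwise inequivalent too. *)

Set Implicit Arguments.
Unset Strict Implicit.
Unset Printing Implicit Defensive.

Local Open Scope classical_set_scope.

(** * Ternary operations inside a clone *)

Section Ternary.
Variable A : finType.
Implicit Types (n : nat) (x y z : A).

Lemma tuple3P (P : 3.-tuple A -> Prop) :
  (forall x y z, P [tuple x; y; z]) -> forall a, P a.
Proof.
move=> HP a; have -> : a = [tuple tnth a ord0; tnth a (inord 1); tnth a (inord 2)].
  apply: eq_from_tnth => -[[|[|[|//]]] Hi]; rewrite [RHS](tnth_nth (tnth a ord0)) /=;
  by congr tnth; apply: val_inj; rewrite /= ?inordK.
exact: HP.
Qed.

Lemma ord3P (P : 'I_3 -> Prop) :
  P ord0 -> P (inord 1) -> P (inord 2) -> forall i, P i.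
Proof.
move=> P0 P1 P2 [[|[|[|//]]] Hi].
- by rewrite (_ : Ordinal Hi = ord0) //; apply: val_inj.
- by rewrite (_ : Ordinal Hi = inord 1) //; apply: val_inj; rewrite /= inordK.
- by rewrite (_ : Ordinal Hi = inord 2) //; apply: val_inj; rewrite /= inordK.
Qed.

Lemma tnth3_0 x y z : tnth [tuple x; y; z] ord0 = x.
Proof. by []. Qed.

Lemma tnth3_1 x y z : tnth [tuple x; y; z] (inord 1) = y.
Proof. by rewrite (tnth_nth x) inordK. Qed.

Lemma tnth3_2 x y z : tnth [tuple x; y; z] (inord 2) = z.
Proof. by rewrite (tnth_nth x) inordK. Qed.

Definition tnth3 := (tnth3_0, tnth3_1, tnth3_2).

Lemma discriminatorE x y z :
  discriminator A [tuple x; y; z] = if x == y then z else x.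
Proof.
rewrite ffunE /= (_ : inord 0 = ord0) ?tnth3 //.
by apply: val_inj; rewrite /= inordK.
Qed.

(** The composite [g(a, b, c)] of a ternary operation with three operations of
    a common arity. *)
Definition comp3 n (g : op A 3) (a b c : op A n) : op A n :=
  Defs.comp g (fun i => if i == ord0 then a else if i == inord 1 then b else c).

Lemma comp3E n (g : op A 3) (a b c : op A n) (s : n.-tuple A) :
  comp3 g a b c s = g [tuple a s; b s; c s].
Proof.
rewrite ffunE; congr (g _); apply: eq_from_tnth => i; rewrite tnth_mktuple.
by elim/ord3P: i; rewrite ?tnth3 -?val_eqE /= ?inordK.
Qed.

Lemma clone_comp3 {C : set (operation A)} n (g : op A 3) (a b c : op A n.+1) :
  is_clone C -> C (Op g) -> C (Op a) -> C (Op b) -> C (Op c) ->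
  C (Op (comp3 g a b c)).
Proof. by move=> [_ CC] Cg Ca Cb Cc; apply: CC => // i; case: ifP => // _; case: ifP. Qed.

(** The ternary projections. *)
Definition p1 : op A 3 := proj A ord0.
Definition p2 : op A 3 := proj A (inord 1).
Definition p3 : op A 3 := proj A (inord 2).

Lemma p1E x y z : p1 [tuple x; y; z] = x. Proof. by rewrite ffunE tnth3. Qed.
Lemma p2E x y z : p2 [tuple x; y; z] = y. Proof. by rewrite ffunE tnth3. Qed.
Lemma p3E x y z : p3 [tuple x; y; z] = z. Proof. by rewrite ffunE tnth3. Qed.

Definition ternE := (comp3E, p1E, p2E, p3E).

End Ternary.

(** * Pattern operations *)

(** Two tuples have the same pattern when the same pairs of positions carry
    equal entries. *)
Definition same_pattern {A : finType} n (a b : n.-tuple A) : Prop :=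
  forall i j, (tnth a i == tnth a j) = (tnth b i == tnth b j).

(** A pattern operation selects one of its arguments, at a position that can be
    chosen to be the same for any two tuples with the same pattern. *)
Definition pattern_op {A : finType} n (f : op A n) : Prop :=
  forall a b, same_pattern a b ->
  exists i, f a = tnth a i /\ f b = tnth b i.

Section Pattern.
Variable A : finType.

Lemma pattern_ops_clone :
  is_clone [set f : operation A | pattern_op (fun_of f)].
Proof.
split=> [n i a b _ | m n g h Hg Hh a b ab]; first by exists i; rewrite !ffunE.
have /choice [k Hk] : forall i, exists j, h i a = tnth a j /\ h i b = tnth b j.
  by move=> i; exact: Hh i a b ab.
have [i j | i [Ha Hb]] := Hg [tuple h i a | i < m.+1] [tuple h i b | i < m.+1].
  by rewrite !tnth_mktuple !(proj1 (Hk _)) !(proj2 (Hk _)).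
exists (k i); rewrite !ffunE.
move: Ha Hb; rewrite /= => -> ->; rewrite !tnth_mktuple; exact: Hk.
Qed.

Lemma same_pattern3 (x y z x' y' z' : A) :
  (x == y) = (x' == y') -> (x == z) = (x' == z') -> (y == z) = (y' == z') ->
  same_pattern [tuple x; y; z] [tuple x'; y'; z'].
Proof.
by move=> xy xz yz; elim/ord3P; elim/ord3P; rewrite !tnth3 ?eqxx // eq_sym
  ?xy ?xz ?yz eq_sym.
Qed.

Lemma pattern_discriminator : pattern_op (discriminator A).
Proof.
elim/tuple3P => x y z; elim/tuple3P => x' y' z' ab; rewrite !discriminatorE.
have := ab ord0 (inord 1); rewrite !tnth3 => <-.
by case: eqP => _; [exists (inord 2) | exists ord0]; rewrite !tnth3.
Qed.

Lemma discriminator_clone_pattern n (f : op A n.+1) :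
  discriminator_clone A (Op f) -> pattern_op f.
Proof.
move=> Df; apply: (Df [set f : operation A | pattern_op (fun_of f)]).
split; first exact: pattern_ops_clone.
by move=> _ ->; exact: pattern_discriminator.
Qed.

End Pattern.

(** * Proper subclones of the discriminator clone *)

Section Subclone.
Variables (A : finType) (H : set (operation A)).
Hypothesis Hclone : is_clone H.
Hypothesis Hpat : forall n (f : op A n.+1), H (Op f) -> pattern_op f.
Hypothesis Ht : ~ H (Op (discriminator A)).
Hypothesis hA : 2 < #|A|.
Variables (u v : A).
Hypothesis uv : u != v.

Let vu : (v == u) = false. Proof. by rewrite eq_sym (negPf uv). Qed.

Lemma H_p1 : H (Op (p1 A)). Proof. exact: Hclone.1. Qed.
Lemma H_p2 : H (Op (p2 A)). Proof. exact: Hclone.1. Qed.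
Lemma H_p3 : H (Op (p3 A)). Proof. exact: Hclone.1. Qed.
Hint Resolve H_p1 H_p2 H_p3 : core.

(** The case analysis carried by [pattern_op] for a ternary operation. *)
Lemma pattern3 (q : op A 3) (x y z x' y' z' : A) : H (Op q) ->
  (x == y) = (x' == y') -> (x == z) = (x' == z') -> (y == z) = (y' == z') ->
  [\/ q [tuple x; y; z] = x /\ q [tuple x'; y'; z'] = x',
      q [tuple x; y; z] = y /\ q [tuple x'; y'; z'] = y' |
      q [tuple x; y; z] = z /\ q [tuple x'; y'; z'] = z'].
Proof.
move=> Hq xy xz yz; have [i] := Hpat Hq (same_pattern3 xy xz yz).
by elim/ord3P: i; rewrite !tnth3 => ?; [constructor 1|constructor 2|constructor 3].
Qed.


(** The hypotheses say that [q] is the discriminator on two-element sets; they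
    leave open which argument [q] selects when all three are distinct. *)
Lemma discriminator_of_binary_discriminator (q : op A 3) : H (Op q) ->
  q [tuple u; u; v] = v -> q [tuple u; v; u] = u -> q [tuple v; u; u] = v ->
  H (Op (discriminator A)).
Proof.
move=> Hq quuv quvu qvuu.
have nuv : u <> v by apply/eqP.
have qxxx x : q [tuple x; x; x] = x.
  by case: (@pattern3 q x x x x x x Hq) => // -[].
have qxxy x y : q [tuple x; x; y] = y.
  have [->|xy] := eqVneq x y; first exact: qxxx.
  by case: (@pattern3 q u u v x x y Hq); rewrite ?eqxx ?(negPf uv) ?(negPf xy)
    // quuv => -[// /esym].
have qxyx x y : q [tuple x; y; x] = x.
  have [->|xy] := eqVneq x y; first exact: qxxx.
  by case: (@pattern3 q u v u x y x Hq); rewrite ?eqxx ?vu ?(negPf uv) ?(negPf xy)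
    // ?(eq_sym y) ?(negPf xy) // quvu => -[// /esym].
have qyxx x y : q [tuple y; x; x] = y.
  have [->|xy] := eqVneq x y; first exact: qxxx.
  by case: (@pattern3 q v u u y x x Hq); rewrite ?eqxx ?vu ?(eq_sym y) ?(negPf xy)
    // qvuu => -[// /esym].
have tE (w : op A 3) : H (Op w) -> (forall x y, w [tuple x; x; y] = y) ->
    (forall x y, w [tuple x; y; x] = x) -> (forall x y, w [tuple y; x; x] = y) ->
    (forall x y z, x != y -> x != z -> y != z -> w [tuple x; y; z] = x) ->
    H (Op (discriminator A)).
  move=> Hw w1 w2 w3 w4; rewrite (_ : discriminator A = w) //; apply/ffunP.
  elim/tuple3P => x y z; rewrite discriminatorE.
  have [->|xy] := eqVneq x y; first by rewrite w1.
  have [->|xz] := eqVneq x z; first by rewrite w2.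
  have [->|yz] := eqVneq y z; first by rewrite w3.
  by rewrite w4.
(* The position selected on triples of distinct elements is read off one such
   triple, which exists as [A] has at least three elements. *)
have [[[a b] c] [/= ab ac bc]] : exists s : A * A * A,
    [/\ s.1.1 != s.1.2, s.1.1 != s.2 & s.1.2 != s.2].
  case/card_gt2P: hA => a [b [c [_ [ab bc ca]]]].
  by exists (a, b, c); split; rewrite //= eq_sym.
have qabc x y z : x != y -> x != z -> y != z ->
    [\/ q [tuple a; b; c] = a /\ q [tuple x; y; z] = x,
        q [tuple a; b; c] = b /\ q [tuple x; y; z] = y |
        q [tuple a; b; c] = c /\ q [tuple x; y; z] = z].
  by move=> /negPf xy /negPf xz /negPf yz; apply: pattern3 => //;
    rewrite ?xy ?xz ?yz; apply: negPf.
have nab : a <> b by apply/eqP.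
have nac : a <> c by apply/eqP.
have nbc : b <> c by apply/eqP.
have [[qa _]|[qb _]|[qc _]] := qabc a b c ab ac bc.
- apply: (tE q) => // x y z xy xz yz.
  by case: (qabc x y z xy xz yz); rewrite qa => -[].
- pose w := comp3 q q (comp3 q q (p1 A) (p3 A)) (p3 A).
  have qd x y z : x != y -> x != z -> y != z -> q [tuple x; y; z] = y.
    by move=> xy xz yz; case: (qabc x y z xy xz yz); rewrite qb => -[// /esym].
  apply: (tE w) => [|x y|x y|x y|x y z xy xz yz]; rewrite /w ?ternE.
  + by do ![apply: clone_comp3 => //].
  + by rewrite !(qxxx, qxxy, qxyx, qyxx).
  + by rewrite !(qxxx, qxxy, qxyx, qyxx).
  + by rewrite !(qxxx, qxxy, qxyx, qyxx).
  + by rewrite (qd x y z) // (qd y x z) ?(qd y x z) // eq_sym.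
- pose w := comp3 q (p3 A) (p2 A) (p1 A).
  apply: (tE w) => [|x y|x y|x y|x y z xy xz yz]; rewrite /w ?ternE //.
  + exact: clone_comp3.
  + by case: (qabc z y x); rewrite 1?eq_sym // qc => -[// /esym].
Qed.

(** No ternary operation in [H] takes the value [v] at exactly two of the three
    tuples [(u,u,v)], [(u,v,u)], [(v,u,u)]. *)
Lemma no_discriminator_triple (q : op A 3) : H (Op q) ->
  [/\ ~ [/\ q [tuple u; u; v] = v, q [tuple u; v; u] = u & q [tuple v; u; u] = v],
      ~ [/\ q [tuple u; u; v] = u, q [tuple u; v; u] = v & q [tuple v; u; u] = v] &
      ~ [/\ q [tuple u; u; v] = v, q [tuple u; v; u] = v & q [tuple v; u; u] = u]].
Proof.
move=> Hq; split=> -[q1 q2 q3]; apply: Ht.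
- exact: (@discriminator_of_binary_discriminator q).
- by apply: (@discriminator_of_binary_discriminator
    (comp3 q (p1 A) (p3 A) (p2 A))); rewrite ?ternE //; exact: clone_comp3.
- by apply: (@discriminator_of_binary_discriminator
    (comp3 q (p2 A) (p1 A) (p3 A))); rewrite ?ternE //; exact: clone_comp3.
Qed.

(** * Boolean tuples over [{u, v}] *)

(** The tuple over [{u, v}] encoding a Boolean vector, [v] standing for
    [true]. *)
Definition bits n (x : 'I_n -> bool) : n.-tuple A :=
  [tuple if x i then v else u | i < n].

Lemma bits_eqv n (x : 'I_n -> bool) i : (tnth (bits x) i == v) = x i.
Proof. by rewrite tnth_mktuple; case: (x i); rewrite ?eqxx ?(negPf uv). Qed.

Lemma bits_val n (f : op A n.+1) (x : 'I_n.+1 -> bool) : H (Op f) ->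
  f (bits x) = if f (bits x) == v then v else u.
Proof.
move=> Hf; have [i [-> _]] := Hpat Hf (fun i j => erefl : _ = (tnth (bits x) i == tnth (bits x) j)).
by rewrite tnth_mktuple; case: (x i); rewrite ?eqxx ?(negPf uv).
Qed.

Lemma map_bits n m (h : 'I_m -> op A n.+1) (x : 'I_n.+1 -> bool) :
  (forall i, H (Op (h i))) ->
  [tuple h i (bits x) | i < m] = bits (fun i => h i (bits x) == v).
Proof.
by move=> Hh; apply: eq_from_tnth => i; rewrite !tnth_mktuple; exact: bits_val.
Qed.

Lemma ternary_val (q : op A 3) : H (Op q) ->
  [/\ q [tuple u; u; v] = u \/ q [tuple u; u; v] = v,
      q [tuple u; v; u] = u \/ q [tuple u; v; u] = v &
      q [tuple v; u; u] = u \/ q [tuple v; u; u] = v].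
Proof.
move=> Hq; split.
- by case: (@pattern3 q u u v u u v Hq) => // -[]; auto.
- by case: (@pattern3 q u v u u v u Hq) => // -[]; auto.
- by case: (@pattern3 q v u u v u u Hq) => // -[]; auto.
Qed.

(** [g] is the minority operation on [{u, v}]. *)
Definition minority (g : op A 3) : Prop :=
  [/\ g [tuple u; u; v] = v, g [tuple u; v; u] = v & g [tuple v; u; u] = v].

(** A failure of monotonicity at [x <= y], after identifying the variables on
    which [(x, y)] is [(1,1)], [(0,1)] or [(0,0)], gives a ternary [k] with
    [k(v,u,u) = v] and [k(v,v,u) = u]; the latter means [k(u,u,v) = v]. *)
Lemma monotone_of_no_minority :
  (forall g, H (Op g) -> ~ minority g) ->
  forall n (f : op A n.+1) (x y : 'I_n.+1 -> bool), H (Op f) ->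
  (forall i, x i -> y i) -> f (bits x) = v -> f (bits y) = v.
Proof.
move=> nomin n f x y Hf xy fx.
rewrite bits_val //; case: eqP => // /eqP fy.
have {fy} fy : f (bits y) = u by rewrite bits_val // (negPf fy).
pose k := Defs.comp f (fun i => if x i then p1 A else if y i then p2 A else p3 A).
have Hk : H (Op k) by apply: Hclone.2 => // i; do 2!case: ifP => // _.
have kx : k [tuple v; u; u] = v.
  rewrite ffunE -[RHS]fx; congr (f _); apply: eq_from_tnth => i; rewrite !tnth_mktuple.
  by case: (x i) => //; last case: (y i); rewrite ternE.
have ky : k [tuple v; v; u] = u.
  rewrite ffunE -[RHS]fy; congr (f _); apply: eq_from_tnth => i; rewrite !tnth_mktuple.
  by have := xy i; case: (x i) => [->//|_]; last case: (y i); rewrite ternE.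
have nuv : u <> v by apply/eqP.
have kv : k [tuple u; u; v] = v.
  by case: (@pattern3 k v v u u u v Hk); rewrite ?eqxx ?vu ?(negPf uv) // ky => -[// /nuv].
exfalso; have [_ [kuvu|kuvu] _] := ternary_val Hk.
- by have [+ _ _] := no_discriminator_triple Hk; apply.
- exact: (nomin k).
Qed.

(** With a minority [g] in [H], the triple of values of a member [k] of [H]
    satisfies [x + y + z = 1]; only the case [x = y] is needed. *)
Lemma no_majority (g k : op A 3) : H (Op g) -> minority g -> H (Op k) ->
  k [tuple u; u; v] = k [tuple u; v; u] -> k [tuple v; u; u] = v.
Proof.
move=> Hg [g1 g2 g3] Hk k12.
have [[k1|k1] _ [k3|//]] := ternary_val Hk; last first.
  by have [_ _ []] := no_discriminator_triple Hk; split; rewrite // -k12.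
pose w := comp3 k (p1 A) (p3 A) g.
have Hw : H (Op w) by exact: clone_comp3.
have k2 : k [tuple u; v; u] = u by rewrite -k12.
have nuv : u <> v by apply/eqP.
have kuvv : k [tuple u; v; v] = v.
  by case: (@pattern3 k v u u u v v Hk); rewrite ?eqxx ?vu ?(negPf uv) // k3 => -[// /nuv].
have kvuv : k [tuple v; u; v] = v.
  by case: (@pattern3 k u v u v u v Hk); rewrite ?eqxx ?vu ?(negPf uv) // k2 => -[// /nuv].
have [[]] := no_discriminator_triple Hw.
by rewrite /w !ternE g1 g2 g3.
Qed.

(** The Boolean vector [fun i => x i == y i] is [x + y + 1] over the two-element
    field. *)
Lemma affine_of_minority (g : op A 3) : H (Op g) -> minority g ->
  forall n (f : op A n.+1) (x y : 'I_n.+1 -> bool), H (Op f) ->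
  f (bits x) = f (bits y) -> f (bits (fun i => x i == y i)) = v.
Proof.
move=> Hg ming n f x y Hf fxy; have [g1 g2 g3] := ming.
pose k := Defs.comp f (fun i => if x i then (if y i then g else p3 A)
                                else if y i then p2 A else p1 A).
have Hk : H (Op k) by apply: Hclone.2 => // i; do 2!case: ifP => // _.
have kE z a b c : (forall i, (if z i then v else u) =
    (if x i then (if y i then g else p3 A)
     else if y i then p2 A else p1 A) [tuple a; b; c]) ->
    k [tuple a; b; c] = f (bits z).
  move=> zE; rewrite ffunE; congr (f _); apply: eq_from_tnth => i.
  by rewrite !tnth_mktuple zE.
rewrite -(kE _ v u u); last by move=> i; case: (x i); case: (y i); rewrite ?ternE.
apply: (no_majority Hg) => //.
by rewrite (kE x) ?(kE y) // => i; do 2!case: ifP => _; rewrite ?ternE.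
Qed.

(** * Infinitely many classes *)

Lemma clone_le_refl (f : operation A) : clone_le H f f.
Proof.
exists (fun i => proj A i); split=> [i|]; first exact: Hclone.1.
apply/ffunP => a; rewrite ffunE; congr (fun_of f _).
by apply: eq_from_tnth => i; rewrite tnth_mktuple ffunE.
Qed.

Lemma infinite_classes (F : forall n, op A n.+1) :
  (forall n m, clone_le H (Op (F n)) (Op (F m)) -> n <= m) ->
  infinite_set (equiv_classes H).
Proof.
move=> F_le; pose E n := [set f | clone_equiv H (Op (F n)) f].
have E_inj : injective E.
  move=> n m Enm; have [nm mn] : clone_equiv H (Op (F n)) (Op (F m)).
    rewrite -[clone_equiv _ _ _]/(E n _) Enm.
    by split; exact: clone_le_refl.
  by apply/eqP; rewrite eqn_leq !F_le.
move=> finH; apply: infinite_nat.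
have -> : [set: nat] = E @^-1` equiv_classes H.
  by apply/esym/seteqP; split=> // n _; exists (Op (F n)).
by apply: finite_preimage => // n m _ _; exact: E_inj.
Qed.

(** The parity of the number of occurrences of [v]. *)
Definition parity_op n : op A n.+1 :=
  [ffun a => if odd #|[pred i | tnth a i == v]| then v else u].

(** The conjunction, for [u] read as false and [v] as true. *)
Definition conj_op n : op A n.+1 :=
  [ffun a => if [forall i, tnth a i == v] then v else u].

Lemma parity_bits n (x : 'I_n.+1 -> bool) :
  parity_op n (bits x) = if odd #|[pred i | x i]| then v else u.
Proof.
rewrite ffunE; congr (if odd _ then _ else _); apply: eq_card => i.
by rewrite !inE bits_eqv.
Qed.

Lemma conj_bits n (x : 'I_n.+1 -> bool) :
  conj_op n (bits x) = if [forall i, x i] then v else u.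
Proof. by rewrite ffunE; under eq_forallb do rewrite bits_eqv. Qed.

Lemma infinite_of_no_minority : (forall g, H (Op g) -> ~ minority g) ->
  infinite_set (equiv_classes H).
Proof.
move=> nomin; apply: (@infinite_classes parity_op) => n m [h [Hh hE]].
have {hE} hE : parity_op n = Defs.comp (parity_op m) h by [].
(* [c k] starts with [k] entries [v], and [W k] is the weight of its image;
   [W] is nondecreasing and [W k] has the parity of [k]. *)
pose c k := bits (fun i : 'I_n.+1 => i < k).
pose W k := #|[pred i : 'I_m.+1 | h i (c k) == v]|.
have W_odd k : k <= n.+1 -> odd (W k) = odd k.
  move=> kn; have : parity_op n (c k) = if odd k then v else u.
    by rewrite parity_bits -sum1_card -(big_ord_widen n.+1 (fun=> 1)) //
      sum1_card card_ord.
  rewrite hE ffunE map_bits // parity_bits -/(W k).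
  by do 2!case: odd => //; move=> /eqP; rewrite ?vu ?(negPf uv).
have W_mono k : W k <= W k.+1.
  apply: subset_leq_card; apply/fintype.subsetP => i; rewrite !inE => /eqP hv.
  apply/eqP; apply: (monotone_of_no_minority nomin) hv => // j; exact: ltnW.
have W_ge k : k <= n.+1 -> k <= W k.
  elim: k => // k IHk kn; apply: leq_ltn_trans (IHk (ltnW kn)) _.
  rewrite ltn_neqAle W_mono andbT; apply/eqP => /(congr1 odd).
  by rewrite !W_odd //= ?(ltnW kn) //; case: odd.
rewrite -ltnS; apply: leq_trans (W_ge n.+1 (leqnn _)) _.
by rewrite -[X in _ <= X]card_ord; exact: max_card.
Qed.

Lemma infinite_of_minority (g : op A 3) : H (Op g) -> minority g ->
  infinite_set (equiv_classes H).
Proof.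
move=> Hg ming; apply: (@infinite_classes conj_op) => n m [h [Hh hE]].
have {hE} hE : conj_op n = Defs.comp (conj_op m) h by [].
(* The map induced by [h] on Boolean vectors. *)
pose phi (x : {ffun 'I_n.+1 -> bool}) : {ffun 'I_m.+1 -> bool} :=
  [ffun j => h j (bits x) == v].
have phi_inj : injective phi.
  move=> x y /ffunP phixy.
  have hz j : h j (bits (fun i => x i == y i)) = v.
    apply: (affine_of_minority Hg) => //.
    by have := phixy j; rewrite !ffunE => hxy; rewrite bits_val // hxy -bits_val.
  have : conj_op n (bits (fun i => x i == y i)) = v.
    rewrite hE ffunE map_bits // conj_bits.
    by rewrite (introT forallP) // => j; rewrite hz.
  rewrite conj_bits; case: forallP => [xy _|_ /eqP]; last by rewrite (negPf uv).
  by apply/ffunP => i; exact/eqP.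
have := leq_card phi phi_inj.
by rewrite !card_ffun !card_ord card_bool leq_exp2l.
Qed.

End Subclone.

Theorem theorem4p11 (A : finType) (hA : 2 < #|A|) (H : set (operation A))
  (Hclone : is_clone H) (Hproper : H `<` discriminator_clone A) :
  infinite_set (equiv_classes H).
Proof.
have [HD nDH] := Hproper.
have Hpat n (f : op A n.+1) : H (Op f) -> pattern_op f.
  by move=> /HD; exact: discriminator_clone_pattern.
have Ht : ~ H (Op (discriminator A)).
  by move=> Ht; apply: nDH; apply: smallest_sub => // _ ->.
have /card_gt1P [u [v [_ _ uv]]] : 1 < #|A| by exact: ltnW.
have [[g [Hg ming]]|nomin] := pselect (exists g, H (Op g) /\ minority u v g).
  exact: (infinite_of_minority Hclone Hpat Ht hA uv Hg ming).
apply: (infinite_of_no_minority Hclone Hpat Ht hA uv) => g Hg ming.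
by apply: nomin; exists g.
Qed.
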